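(* One has $$\mathsf V(S_c^*(\{a\}^+))=\bigvee_{n\ge1}\mathsf V(S_c^*(a^n))=\mathsf V((\mathbb N_0,\max,+)).$$ This variety is nonfinitely based.
   Context: An ai-semiring (additively idempotent semiring) is an algebra $(S,+,\cdot)$ with two binary operations such that $(S,+)$ is a commutative idempotent semigroup, $(S,\cdot)$ is a semigroup, and both distributive laws hold. The signature is $(+,\cdot)$, with two binary operation symbols and no constants. $\mathsf V(S)$ denotes the variety generated by $S$, and $\bigvee$ is the join in the lattice of varieties. A variety is finitely based if its identities all follow from a finite set of them; otherwise it is nonfinitely based. For $n\ge 1$, $S_c^*(a^n)$ is the ai-semiring with universe $\{a,a^2,\ldots,a^n,0\}$ ($n+1$ distinct elements), where $0$ is absorbing for both addition and multiplication, $a^i+a^j=a^{\max\{i,j\}}$, and $a^i a^j=a^{i+j}$ if $i+j\le n$, $a^ia^j=0$ if $i+j>n$. $S_c^*(\{a\}^+)$ is the ai-semiring with universe $\{a^i:i\ge1\}\cup\{0\}$, where $0$ is absorbing for both operations, $a^i+a^j=a^{\max\{i,j\}}$ and $a^ia^j=a^{i+j}$. $(\mathbb N_0,\max,+)$ is the ai-semiring on the nonnegative integers whose semiring addition is $\max$ and whose semiring multiplication is ordinary addition of integers. *)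

(* Defs.v *)
From mathcomp Require Import all_boot.
From mathcomp Require Import boolp classical_sets cardinality.

Set Implicit Arguments.
Unset Strict Implicit.
Unset Printing Implicit Defensive.

Local Open Scope classical_set_scope.

(* Nonempty algebras of signature (+, .), without any axiom. *)
Record algebra := Algebra {
  carrier :> Type;
  add : carrier -> carrier -> carrier;
  mul : carrier -> carrier -> carrier;
  carrier_inhabited : inhabited carrier
}.

Definition ai_semiring (A : algebra) : Prop :=
  [/\ [/\ associative (@add A), commutative (@add A) & idempotent_op (@add A)],
      associative (@mul A),
      left_distributive (@mul A) (@add A) &
      right_distributive (@mul A) (@add A)].

Definition is_hom (A B : algebra) (f : A -> B) : Prop :=
  {morph f : x y / add x y} /\ {morph f : x y / mul x y}.

Definition product (I : Type) (F : I -> algebra) : algebra :=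
  {| carrier := forall i, F i;
     add := fun x y i => add (x i) (y i);
     mul := fun x y i => mul (x i) (y i);
     carrier_inhabited :=
       inhabits (fun i => inhabited_witness (carrier_inhabited (F i))) |}.

Definition closed_hom_images (K : set algebra) : Prop :=
  forall (A B : algebra) (f : A -> B),
    is_hom f -> (forall y, exists x, f x = y) -> K A -> K B.

(* Subalgebras are taken up to isomorphism, as injective homomorphisms. *)
Definition closed_subalgebras (K : set algebra) : Prop :=
  forall (A B : algebra) (f : B -> A), is_hom f -> injective f -> K A -> K B.

Definition closed_products (K : set algebra) : Prop :=
  forall (I : Type) (F : I -> algebra), (forall i, K (F i)) -> K (product F).

Definition variety (K : set algebra) : Prop :=
  [/\ closed_hom_images K, closed_subalgebras K & closed_products K].

Definition V (A : algebra) : set algebra := smallest variety [set A].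

(* The join, in the lattice of varieties, of the family (W i), i in D. *)
Definition variety_join (I : Type) (D : set I) (W : I -> set algebra) :
    set algebra :=
  smallest variety (\bigcup_(i in D) W i).

Inductive term : Type :=
| Var of nat
| Add of term & term
| Mul of term & term.

Fixpoint eval (A : algebra) (v : nat -> A) (t : term) : A :=
  match t with
  | Var n => v n
  | Add s t => add (eval v s) (eval v t)
  | Mul s t => mul (eval v s) (eval v t)
  end.

Definition identity : Type := (term * term)%type.

Definition satisfies (A : algebra) (e : identity) : Prop :=
  forall v : nat -> A, eval v e.1 = eval v e.2.

Definition identities_of (K : set algebra) : set identity :=
  [set e | forall A, K A -> satisfies A e].

Definition follows_from (E : set identity) (e : identity) : Prop :=
  forall A : algebra, (forall e', E e' -> satisfies A e') -> satisfies A e.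

Definition finitely_based (K : set algebra) : Prop :=
  exists E : set identity,
    [/\ finite_set E, E `<=` identities_of K &
        forall e, identities_of K e -> follows_from E e].

Definition nonfinitely_based (K : set algebra) : Prop := ~ finitely_based K.

(* The algebra {a^i : P i} with an absorbing 0 adjoined: Some i stands for a^i
   and None for 0.  [insub k] is a^k when P k holds, and 0 otherwise; since P is
   closed under maxn, a sum of two nonzero elements is never 0. *)
Definition a_powers (P : pred nat) : algebra :=
  {| carrier := option {i : nat | P i};
     add := fun x y =>
       if (x, y) is (Some i, Some j) then insub (maxn (val i) (val j)) else None;
     mul := fun x y =>
       if (x, y) is (Some i, Some j) then insub (val i + val j) else None;
     carrier_inhabited := inhabits None |}.

Definition Sc_star (n : nat) : algebra := a_powers (fun i => 0 < i <= n).

Definition Sc_star_aplus : algebra := a_powers (fun i => 0 < i).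

Definition N0_max_plus : algebra :=
  {| carrier := nat; add := maxn; mul := addn;
     carrier_inhabited := inhabits 0 |}.

Lemma a_powers_ai (P : pred nat) :
  (forall i, P i -> 0 < i) -> (forall i j, 0 < i -> i <= j -> P j -> P i) ->
  ai_semiring (a_powers P).
Proof.
move=> P_gt0 P_down.
have pos (i : {i | P i}) : 0 < val i by exact: P_gt0 (valP i).
have Pmax (i j : {i | P i}) : P (maxn (val i) (val j)).
  by rewrite /maxn; case: ifP => _; exact: valP.
pose mx i j : {i | P i} := Sub _ (Pmax i j).
have insmx i j : insub (maxn (val i) (val j)) = Some (mx i j).
  by rewrite insubT; congr Some; apply: val_inj.
have insN (k l : nat) : 0 < k -> k <= l -> ~~ P k -> insub l = None :> option {i | P i}.
  by move=> k0 kl nPk; apply: insubN; apply: contra nPk; exact: P_down.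
have addC : commutative (@add (a_powers P)).
  by move=> [i|] [j|] //=; rewrite maxnC.
have mulC : commutative (@mul (a_powers P)).
  by move=> [i|] [j|] //=; rewrite addnC.
have dist : left_distributive (@mul (a_powers P)) (@add (a_powers P)).
  move=> [i|] [j|] [k|] //=; rewrite ?insmx //=; last by case: insubP.
  wlog ij : i j / val i <= val j => [hw|].
    case/orP: (leq_total (val i) (val j)) => /hw //.
    by move=> h; rewrite maxnC h; apply: addC.
  rewrite (maxn_idPr ij); have ijk := leq_add ij (leqnn (val k)).
  case: (insubP _ (val i + val k)) => /= [u _ ui|nPi]; last first.
    by apply: (insN _ _ _ ijk nPi); rewrite addn_gt0 pos.
  case: insubP => //= w _ wj; rewrite ui wj (maxn_idPr ijk) -wj; exact/esym/valK.
split => //.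
- split => //.
  + by move=> [i|] [j|] [k|] //=; rewrite ?insmx //= ?insmx; congr Some; apply: val_inj; exact: maxnA.
  + by move=> [i|] //=; rewrite maxnn valK.
- move=> [i|] [j|] [k|] //=; last by case: insubP.
  case: (insubP _ (val j + val k)) => /= [u _ ui|nPjk];
    case: (insubP _ (val i + val j)) => /= [w _ wi|nPij] //.
  + by rewrite ui wi addnA.
  + by rewrite ui addnA; apply: (insN _ _ _ (leq_addr _ _) nPij); rewrite addn_gt0 pos.
  + rewrite wi -addnA; apply/esym.
    by apply: (insN _ _ _ (leq_addl _ _) nPjk); rewrite addn_gt0 pos.
- by move=> x y z; rewrite mulC dist !(mulC x).
Qed.

Lemma Sc_star_ai (n : nat) : ai_semiring (Sc_star n).
Proof.
apply: a_powers_ai => [i /andP[]//|i j i0 ij /andP[_ jn]].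
by rewrite i0 (leq_trans ij).
Qed.

Lemma Sc_star_aplus_ai : ai_semiring Sc_star_aplus.
Proof. exact: a_powers_ai. Qed.

Lemma N0_max_plus_ai : ai_semiring N0_max_plus.
Proof.
split; first split.
- exact: maxnA.
- exact: maxnC.
- exact: maxnn.
- exact: addnA.
- by move=> x y z; rewrite /= addn_maxl.
- by move=> x y z; rewrite /= addn_maxr.
Qed.

(* Main.v *)
Require Import Defs.
From mathcomp Require Import all_boot all_order all_algebra.
From mathcomp Require Import boolp classical_sets cardinality.
From mathcomp Require Import zify ring lra.
(* mathcomp's own [mul] would otherwise hide the one of Defs. *)
Import Defs.

(** The three varieties coincide because each generator is a quotient of a
    subalgebra of a product of the others: N0 is recovered from sequences of
    positive integers growing like [c * k] up to a bounded error, and the zero of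
    S_c^*({a}^+) is the class of the unbounded sequences of N0.

    For the basis, consider the valid identities saying that [x^p + y^p] absorbs
    [x^(p-1) y], with p prime.  In an identity [l = r] valid in N0, every monomial
    of r is dominated by a convex combination of monomials of l (Farkas), and the
    denominators of these combinations are bounded over a finite set of identities.
    Take p prime and larger.  A step from [x^p + y^p] to a mixed monomial
    [x^j y^(p-j)], 0 < j < p, would come from a convex combination of images equal
    to [x^p] or [y^p], whence p | N j with N < p the denominator: impossible.  The
    algebra [graded p] turns this into a model: it remembers only the degree of the
    leading form and whether this form is a pure power of x, of y, or neither, and
    collapses what exceeds degree p as well as the products of degree p that are
    not pure. *)

Set Implicit Arguments.
Unset Strict Implicit.
Unset Printing Implicit Defensive.
Import Order.TTheory GRing.Theory Num.Theory.

(** * Equality of the varieties *)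

Local Open Scope classical_set_scope.

Lemma smallest_variety (G : set algebra) : variety (smallest variety G).
Proof.
split.
- move=> A B f hf sf KA K [vK GK]; case: (vK) => vH _ _.
  by apply: (vH A B f hf sf); exact: KA.
- move=> A B f hf jf KA K [vK GK]; case: (vK) => _ vS _.
  by apply: (vS A B f hf jf); exact: KA.
- move=> I F KF K [vK GK]; case: (vK) => _ _ vP.
  by apply: vP => i; exact: KF.
Qed.

Lemma V_gen (A : algebra) : V A A.
Proof. by move=> K [_]; apply. Qed.

Lemma V_min (K : set algebra) (A : algebra) : variety K -> K A -> V A `<=` K.
Proof. by move=> vK KA B; apply; split=> // _ ->. Qed.

Section Quotient.
Variables (I : Type) (F : I -> algebra) (B : algebra) (R : product F -> B -> Prop).
Hypothesis R_add : forall x y b c, R x b -> R y c -> R (add x y) (add b c).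
Hypothesis R_mul : forall x y b c, R x b -> R y c -> R (mul x y) (mul b c).

Definition rel_dom := {x : product F | exists b, R x b}.

Lemma rel_dom_add (x y : rel_dom) : exists b, R (add (sval x) (sval y)) b.
Proof. by case: x y => x [b xb] [y [c yc]]; exists (add b c); exact: R_add. Qed.

Lemma rel_dom_mul (x y : rel_dom) : exists b, R (mul (sval x) (sval y)) b.
Proof. by case: x y => x [b xb] [y [c yc]]; exists (mul b c); exact: R_mul. Qed.

Hypothesis R_fun : forall x b c, R x b -> R x c -> b = c.
Hypothesis R_onto : forall b, exists x, R x b.

(** By the four hypotheses, [R] is the graph of a homomorphism from the subalgebra [rel_dom] of the
    product onto [B]. *)
Lemma variety_quotient (K : set algebra) :
  variety K -> (forall i, K (F i)) -> K B.
Proof.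
move=> [vH vS vP] KF.
have inh : inhabited rel_dom.
  have [b] := carrier_inhabited B; have [x xb] := R_onto b.
  by constructor; exists x; exists b.
pose S := Algebra (fun x y => exist _ _ (rel_dom_add x y))
  (fun x y => exist _ _ (rel_dom_mul x y)) inh.
have KS : K S.
  apply: (vS (product F) S (fun x : S => sval x)) => [//||]; last exact: vP.
  by move=> [x hx] [y hy] /= xy; subst y; congr exist; exact: Prop_irrelevance.
pose g (x : S) : B := sval (cid (svalP x)).
have gP (x : S) : R (sval x) (g x) by exact: svalP (cid (svalP x)).
apply: (vH S B g) => // [|b].
  split=> x y; first exact: (R_fun (gP (add x y)) (R_add (gP x) (gP y))).
  exact: (R_fun (gP (mul x y)) (R_mul (gP x) (gP y))).
have [x xb] := R_onto b.
pose z : S := exist _ x (ex_intro _ b xb).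
by exists z; exact: (R_fun (gP z) xb).
Qed.

End Quotient.

Definition truncation (n : nat) (x : Sc_star_aplus) : Sc_star n :=
  if x is Some i then insub (val i) else None.

(** The powers above [a^n] and 0 form one congruence class: either operation sends a member of this
    set and any element back into it. *)
Lemma truncation_hom (n : nat) : is_hom (@truncation n).
Proof.
pose ins k : Sc_star n := insub k.
have insN k : n < k -> ins k = None by move=> nk; apply: insubN; lia.
have insE k : 0 < k -> truncation n (insub k) = ins k.
  by move=> k0; rewrite (insubT (fun k => 0 < k) k0).
have tE i (i0 : 0 < i) : truncation n (Some (Sub i i0)) = ins i by [].
have insA i j : 0 < i -> 0 < j -> ins (maxn i j) = add (ins i) (ins j).
  move=> i0 j0; rewrite {2 3}/ins.
  case: insubP => [u _ /= ui|/= ni]; last by apply: insN; lia.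
  case: insubP => [w _ /= wj|/= nj]; last by apply: insN; lia.
  by rewrite /= ui wj.
have insM i j : 0 < i -> 0 < j -> ins (i + j) = mul (ins i) (ins j).
  move=> i0 j0; rewrite {2 3}/ins.
  case: insubP => [u _ /= ui|/= ni]; last by apply: insN; lia.
  case: insubP => [w _ /= wj|/= nj]; last by apply: insN; lia.
  by rewrite /= ui wj.
have addN (x : Sc_star n) : add x None = None by case: x.
have mulN (x : Sc_star n) : mul x None = None by case: x.
split=> [[[i i0]|] [[j j0]|]|[[i i0]|] [[j j0]|]] //; rewrite ?addN ?mulN //.
- by rewrite /add /= insE ?insA //; lia.
- by rewrite /mul /= insE ?insM //; lia.
Qed.

Lemma truncation_onto (n : nat) (y : Sc_star n) : exists x, truncation n x = y.
Proof.
case: y => [[i hi]|]; last by exists None.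
have i0 : 0 < i by case/andP: hi.
by exists (Some (Sub i i0)); rewrite /= insubT.
Qed.

Lemma Sc_star_in_aplus (n : nat) : V Sc_star_aplus (Sc_star n).
Proof.
have [vH _ _] := smallest_variety [set Sc_star_aplus].
apply: (vH _ _ (@truncation n)) (@V_gen _); first exact: truncation_hom.
exact: truncation_onto.
Qed.

(** The truncations at all levels are jointly injective. *)
Lemma aplus_in_variety (K : set algebra) :
  variety K -> (forall n, 0 < n -> K (Sc_star n)) -> K Sc_star_aplus.
Proof.
move=> [_ vS vP] KS.
pose f (x : Sc_star_aplus) : product (fun n => Sc_star n.+1) :=
  fun n => truncation n.+1 x.
apply: (vS _ _ f) (vP _ _ (fun n => KS n.+1 isT)).
  by split=> x y; apply: functional_extensionality_dep => n;
    [exact: (truncation_hom _).1|exact: (truncation_hom _).2].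
have trE n i (i0 : 0 < i) (hi : i <= n) :
    truncation n (Some (Sub i i0) : Sc_star_aplus) =
    Some (Sub i (introT andP (conj i0 hi))).
  by apply: insubT.
move=> [[i i0]|] [[j j0]|] // fij.
- have := congr1 (fun g => g (maxn i j)) fij; rewrite /f.
  rewrite (trE _ _ i0 (leq_trans (leq_maxl i j) _)) //.
  rewrite (trE _ _ j0 (leq_trans (leq_maxr i j) _)) // => -[ij].
  by congr Some; apply: val_inj.
- by have := congr1 (fun g => g i) fij; rewrite /f trE.
- by have := congr1 (fun g => g j) fij; rewrite /f trE.
Qed.

(** The exponent 0 is missing from the powers of [a], so [c] is represented by a growth rate: the
    bounded excess over [c * k] does not affect it. *)
Lemma N0_in_aplus : V Sc_star_aplus N0_max_plus.
Proof.
pose R (x : product (fun _ : nat => Sc_star_aplus)) (c : N0_max_plus) :=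
  exists d, forall k, exists2 i, x k = Some i & c * k <= val i <= c * k + d.
apply: (@variety_quotient _ _ N0_max_plus R) (smallest_variety _) _.
- move=> x y b c [d hx] [d' hy]; exists (d + d') => k.
  have [[i i0] /= xi hi] := hx k; have [[j j0] /= yj hj] := hy k.
  rewrite /= xi yj insubT /= => [|h]; first lia.
  eexists; first by [].
  by move=> /=; rewrite maxnMl; lia.
- move=> x y b c [d hx] [d' hy]; exists (d + d') => k.
  have [[i i0] /= xi hi] := hx k; have [[j j0] /= yj hj] := hy k.
  rewrite /= xi yj insubT /= => [|h]; first lia.
  eexists; first by [].
  by move=> /=; rewrite mulnDl; lia.
- move=> x b c [d hb] [d' hc].
  (* At an index above both errors, distinct rates give disjoint intervals. *)
  have [i xi hi] := hb (d + d').+1; have [j xj hj] := hc (d + d').+1.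
  move: hj; rewrite -(Some_inj (etrans (esym xi) xj)) => hj.
  by case: (ltngtP b c) => // bc; exfalso; nia.
(* The successor keeps the exponent positive when [c * k = 0], at the cost of an error 1. *)
- move=> c; exists (fun k => Some (Sub (c * k).+1 isT)), 1 => k.
  by eexists; first by []; rewrite /=; lia.
- by move=> _; exact: V_gen.
Qed.

Lemma aplus_in_N0 : V N0_max_plus Sc_star_aplus.
Proof.
pose R (f : product (fun _ : nat => N0_max_plus)) (x : Sc_star_aplus) :=
  if x is Some i then forall k, f k = val i else forall b, exists k, b < f k.
(* Maximum and sum are at least each operand, so unboundedness passes to the result; this covers all
   cases involving 0. *)
have RN f g x y : R f x -> R g y ->
    (if (x, y) is (Some _, Some _) then True else
     forall h : nat -> nat, (forall k, f k <= h k /\ g k <= h k) -> R h None).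
  case: x y => [i|] [j|] //= Rf Rg h fgh b.
  - by have [k bk] := Rg b; exists k; apply: leq_trans bk (fgh k).2.
  - by have [k bk] := Rf b; exists k; apply: leq_trans bk (fgh k).1.
  - by have [k bk] := Rg b; exists k; apply: leq_trans bk (fgh k).2.
apply: (@variety_quotient _ _ Sc_star_aplus R) (smallest_variety _) _.
- move=> f g x y Rf Rg; have := RN f g x y Rf Rg.
  case: x y Rf Rg => [[i i0]|] [[j j0]|] /= Rf Rg; last 3 first.
  1-3: by apply=> k; rewrite leq_maxl leq_maxr.
  by rewrite insubT /= => [|h _ k]; [lia|rewrite Rf Rg].
- move=> f g x y Rf Rg; have := RN f g x y Rf Rg.
  case: x y Rf Rg => [[i i0]|] [[j j0]|] /= Rf Rg; last 3 first.
  1-3: by apply=> k; rewrite leq_addl leq_addr.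
  by rewrite insubT /= => [|h _ k]; [lia|rewrite Rf Rg].
- move=> f [i|] [j|] //= Rf Rg.
  + by congr Some; apply: val_inj; exact: etrans (esym (Rf 0)) (Rg 0).
  + by have [k] := Rg (val i); rewrite Rf ltnn.
  + by have [k] := Rf (val j); rewrite Rg ltnn.
- by move=> [i|]; [exists (fun=> val i)|exists (fun k => k.+1) => b; exists b].
- by move=> _; exact: V_gen.
Qed.

(** The models of one identity form a variety. *)
Lemma V_satisfies (A : algebra) (e : identity) :
  satisfies A e -> identities_of (V A) e.
Proof.
move=> Ae; apply: (@V_min (fun B => satisfies B e) A _ Ae); split.
- move=> B C f [fa fm] sf Be v.
  have [w vw] := choice (fun n => sf (v n)).
  have ev t : eval v t = f (eval w t).
    by elim: t => [n|s IHs t IHt|s IHs t IHt] /=; rewrite ?vw ?fa ?fm ?IHs ?IHt.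
  by rewrite !ev Be.
- move=> B C f [fa fm] jf Be v; apply: jf.
  have ev t : f (eval v t) = eval (f \o v) t.
    by elim: t => [n|s IHs t IHt|s IHs t IHt] //=; rewrite ?fa ?fm IHs IHt.
  by rewrite !ev Be.
- move=> I F FA v; apply: functional_extensionality_dep => i.
  have ev t : eval v t i = eval (fun n => v n i) t.
    by elim: t => [n|s IHs t IHt|s IHs t IHt] //=; rewrite IHs IHt.
  by rewrite !ev FA.
Qed.

Local Close Scope classical_set_scope.

(** * Farkas' lemma *)

Section Farkas.
Local Open Scope ring_scope.

Lemma seq_between (A B : seq rat) :
  (forall a b, a \in A -> b \in B -> a < b) ->
  exists q, (forall a, a \in A -> a < q) /\ (forall b, b \in B -> q < b).
Proof.
elim: A => [_|a A IH AB].
  elim: B => [|b B [q [_ qB]]]; first by exists 0.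
  exists (Num.min q (b - 1)); split=> // c; rewrite inE => /orP[/eqP->|/qB qc].
    by rewrite gt_min; apply/orP; right; lra.
  by rewrite gt_min qc.
have [|q [Aq qB]] := IH; first by move=> c b cA; apply: AB; rewrite inE cA orbT.
have [qa|aq] := lerP q a; last first.
  by exists q; split=> // c; rewrite inE => /orP[/eqP->//|/Aq].
have {IH} : forall b, b \in B -> a < b by move=> b; apply: AB; rewrite inE eqxx.
(* Since [q <= a], whatever exceeds [a] also exceeds all of [A]; it remains to stay below [B]. *)
elim: B {AB qB} => [|b B IH] aB.
  exists (a + 1); split=> // c; rewrite inE => /orP[/eqP->|/Aq]; lra.
have [|r [Ar rB]] := IH; first by move=> c cB; apply: aB; rewrite inE cB orbT.
have ab : a < b by apply: aB; rewrite inE eqxx.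
exists (Num.min r ((a + b) / 2)); split=> c.
  move=> cA; rewrite lt_min Ar //=; move: cA.
  rewrite inE => /orP[/eqP->|/Aq]; lra.
by rewrite inE => /orP[/eqP->|/rB rc]; rewrite gt_min ?rc //; apply/orP; right; lra.
Qed.

(* Fourier-Motzkin elimination of the last coordinate. *)
Lemma farkas (n : nat) (P : (nat -> int) -> Prop) (L : seq (nat -> int)) :
  (forall x y, P x -> P y -> P (x \+ y)) ->
  (forall x, x \in L -> P x) ->
  (forall x, P x -> ~ forall i, (i < n)%N -> x i <= 0) ->
  exists v : nat -> nat, forall x, x \in L -> 0 < \sum_(i < n) x i * (v i)%:Z.
Proof.
elim: n P L => [|n IH] P L PD PL Pn.
  exists (fun=> 0%N) => x /PL /Pn[] //.
have PM x k : P x -> (0 < k)%R -> P (fun i => k * x i).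
  case: k => // k Px; elim: k => // k IHk _.
  case: (posnP k) => [->|k0].
    have -> // : (fun i => 1%:Z * x i) = x.
    by apply: functional_extensionality_dep => i; rewrite mul1r.
  have -> : (fun i => k.+1%:Z * x i) = x \+ (fun i => k%:Z * x i).
    by apply: functional_extensionality_dep => i /=; rewrite -addn1 PoszD; ring.
  by apply: PD => //; apply: IHk.
pose Lp := [seq x <- L | 0 < x n]; pose Ln := [seq x <- L | x n < 0].
(* The positive combination of [a] and [b] whose coordinate [n] vanishes. *)
pose pair (a b : nat -> int) := (fun i => a n * b i) \+ (fun i => - b n * a i).
pose L' := [seq x <- L | x n <= 0] ++ [seq pair a b | a <- Lp, b <- Ln].
(* Restricting [P] to [x n <= 0] supplies the sign of the coordinate that the induction hypothesis
   ignores. *)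
have [|||v vL'] := IH (fun x => P x /\ x n <= 0) L'.
- by move=> x y [Px x0] [Py y0]; split; [exact: PD|rewrite /=; lia].
- move=> x; rewrite mem_cat => /orP[|/allpairsP[[a b] /= []]].
    by rewrite mem_filter => /andP[-> /PL].
  rewrite !mem_filter => /andP[a0 /PL Pa] /andP[b0 /PL Pb] ->; split.
    by apply: PD; apply: PM => //; lia.
  by rewrite /pair /=; lia.
- move=> x [Px xn] x0; apply: (Pn _ Px) => i; rewrite ltnS leq_eqVlt.
  by move=> /orP[/eqP->//|/x0].
pose s (x : nat -> int) := \sum_(i < n) x i * (v i)%:Z.
have sL x : x \in L -> x n <= 0 -> 0 < s x.
  by move=> xL xn; apply: vL'; rewrite mem_cat mem_filter xn xL.
have sP a b : a \in Lp -> b \in Ln -> 0 < a n * s b - b n * s a.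
  move=> aL bL; have : 0 < s (pair a b).
    by apply: vL'; rewrite mem_cat; apply/orP; right; apply/allpairsP; exists (a, b).
  rewrite /s /pair /= (eq_bigr (fun i : 'I_n =>
    a n * (b i * (v i)%:Z) + - b n * (a i * (v i)%:Z))).
    by rewrite big_split /= -!mulr_sumr mulNr.
  by move=> i _; ring.
(* With [q] as last coordinate, positivity means [lo a < q] if [0 < a n], and [q < up b] if
   [b n < 0]. The extra lower bound 0 makes [q] positive; its denominator [K] is cleared at the
   end. *)
pose lo (a : nat -> int) : rat := - (s a)%:~R / (a n)%:~R.
pose up (b : nat -> int) : rat := (s b)%:~R / (- b n)%:~R.
have [a b|q [loq qup]] := seq_between (A := 0 :: map lo Lp) (B := map up Ln).
  rewrite inE => /orP[/eqP->|/mapP[x xL ->]] /mapP[y yL ->].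
    move: yL; rewrite mem_filter => /andP[y0 yL].
    by rewrite divr_gt0 // ltr0z ?oppr_gt0 // sL // ltW.
  have := sP _ _ xL yL; move: xL yL; rewrite !mem_filter => /andP[x0 _] /andP[y0 _] h.
  rewrite /lo /up ltr_pdivrMr ?ltr0z // mulrAC ltr_pdivlMr ?ltr0z ?oppr_gt0 //.
  by rewrite -!rmorphN -!rmorphM /= ltr_int; lia.
have q0 : 0 < q by apply: loq; rewrite inE eqxx.
pose K := `|denq q|%N; pose t := `|numq q|%N.
have K0 : (0 < K)%N by rewrite absz_gt0 denq_eq0.
have Kr : 0 < K%:Z%:~R :> rat by rewrite ltr0z.
have qE : q = t%:Z%:~R / K%:Z%:~R.
  rewrite /t /K !gez0_abs ?denq_ge0 // ?divq_num_den //.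
  by rewrite numq_ge0 ltW.
exists (fun i => if i == n then t else (K * v i)%N) => x xL.
rewrite big_ord_recr /= eqxx.
rewrite (eq_bigr (fun i : 'I_n => K%:Z * (x i * (v i)%:Z))); last first.
  by move=> i _; rewrite (ltn_eqF (ltn_ord i)) PoszM; ring.
rewrite -mulr_sumr -/(s x).
case: (ltgtP (x n) 0) => xn.
- have /qup : up x \in map up Ln by rewrite map_f // mem_filter xn.
  rewrite qE /up ltr_pdivrMr // mulrAC ltr_pdivlMr ?ltr0z ?oppr_gt0 //.
  by rewrite -!rmorphM /= ltr_int; lia.
- have /loq : lo x \in 0 :: map lo Lp by rewrite inE map_f ?orbT // mem_filter xn.
  rewrite qE /lo ltr_pdivrMr ?ltr0z // mulrAC ltr_pdivlMr //.
  by rewrite -!rmorphN -!rmorphM /= ltr_int; lia.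
- by rewrite xn mul0r addr0 mulr_gt0 // sL // xn.
Qed.

End Farkas.

(** * Monomials of a term *)

Fixpoint monomials (t : term) : seq (seq nat) :=
  match t with
  | Var n => [:: [:: n]]
  | Add s t => monomials s ++ monomials t
  | Mul s t => [seq a ++ b | a <- monomials s, b <- monomials t]
  end.

Definition weight (f : nat -> nat) (m : seq nat) : nat := \sum_(z <- m) f z.

Lemma weight_cat f a b : weight f (a ++ b) = weight f a + weight f b.
Proof. exact: big_cat. Qed.

Lemma leq_weight f g m : (forall z, f z <= g z) -> weight f m <= weight g m.
Proof. by move=> fg; apply: leq_sum. Qed.

Lemma weightD f g m : weight (fun z => f z + g z) m = weight f m + weight g m.
Proof. exact: big_split. Qed.

Lemma mem_leq_weight f z m : z \in m -> f z <= weight f m.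
Proof. by move=> zm; rewrite /weight (big_rem z) //= leq_addr. Qed.

Lemma weight_flatten f ms : weight f (flatten ms) = \sum_(m <- ms) weight f m.
Proof. exact: big_flatten. Qed.

(** A weight becomes an inner product in [n] coordinates, the form in [farkas]. *)
Lemma weight_count (n : nat) f m : {in m, forall z, z < n} ->
  weight f m = \sum_(i < n) count_mem (i : nat) m * f i.
Proof.
elim: m => [|z m IH] mn; first by rewrite /weight big_nil big1.
rewrite /weight big_cons -/(weight f m) IH => [|y ym]; last first.
  by apply: mn; rewrite inE ym orbT.
have zn : z < n by apply: mn; rewrite inE eqxx.
rewrite /= [RHS](eq_bigr (fun i : 'I_n =>
  (if i == Ordinal zn then f i else 0) + count_mem (i : nat) m * f i)).
    by rewrite big_split /= -big_mkcond big_pred1_eq.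
move=> i _; rewrite mulnDl; congr (_ + _).
by rewrite -val_eqE /= eq_sym; case: eqP => _; rewrite ?mul1n.
Qed.

Lemma eval_N0 (v : nat -> N0_max_plus) t :
  (forall m, m \in monomials t -> weight v m <= eval v t) /\
  exists2 m, m \in monomials t & weight v m = eval v t.
Proof.
elim: t => [n|s [sle [a sa aE]] t [tle [b tb bE]]|s [sle [a sa aE]] t [tle [b tb bE]]] /=.
- rewrite /weight; split=> [m|]; first by rewrite inE => /eqP->; rewrite big_seq1.
  by exists [:: n]; rewrite ?inE // big_seq1.
- split=> [m|].
    by rewrite mem_cat leq_max => /orP[/sle->//|/tle->]; rewrite orbT.
  case: (leqP (eval v s) (eval v t)) => st.
    by exists b; rewrite ?mem_cat ?tb ?orbT.
  by exists a; rewrite ?mem_cat ?sa.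
- split=> [m /allpairsP[[x y] /= [xs yt ->]]|].
    by rewrite weight_cat leq_add ?sle ?tle.
  by exists (a ++ b); [apply/allpairsP; exists (a, b)|rewrite weight_cat aE bE].
Qed.

(* The convex combination is given by its common denominator [size ms] and
   the list [ms], in which a monomial is repeated according to its coefficient. *)
Lemma convex_domination l r u : satisfies N0_max_plus (l, r) ->
  u \in monomials r ->
  exists ms : seq (seq nat),
    [/\ 0 < size ms, {subset ms <= monomials l} &
        forall f, size ms * weight f u <= \sum_(m <- ms) weight f m].
Proof.
move=> lr ur.
pose n := (\max_(z <- flatten (u :: monomials l)) z).+1.
have bnd z : z \in flatten (u :: monomials l) -> z < n.
  by move=> zf; rewrite ltnS; apply: leq_bigmax_seq.
have un : {in u, forall z, z < n} by move=> z zu; apply: bnd; rewrite /= mem_cat zu.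
have ln m : m \in monomials l -> {in m, forall z, z < n}.
  move=> ml z zm; apply: bnd; rewrite /= mem_cat; apply/orP; right.
  by apply/flattenP; exists m.
pose D (ms : seq (seq nat)) (z : nat) : int :=
  ((size ms * count_mem z u)%N%:Z - (count_mem z (flatten ms))%:Z)%R.
pose P y := exists ms, [/\ 0 < size ms, {subset ms <= monomials l} & y = D ms].
(* Without such a list, Farkas yields a valuation under which [u] outweighs every monomial of [l],
   against the identity. *)
apply: contrapT => nms.
have [|||v vL] := farkas (n := n) (P := P) (L := [seq D [:: m] | m <- monomials l]).
- move=> _ _ [ms [ms0 msl ->]] [ms' [_ msl' ->]]; exists (ms ++ ms'); split.
  + by rewrite size_cat addn_gt0 ms0.
  + by move=> m; rewrite mem_cat => /orP[/msl|/msl'].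
  + apply: functional_extensionality_dep => z.
    by rewrite /D /= size_cat flatten_cat count_cat mulnDl; lia.
- move=> _ /mapP[m ml ->]; exists [:: m]; split=> // m'.
  by rewrite inE => /eqP->.
- move=> _ [ms [ms0 msl ->]] Dle; apply: nms; exists ms; split=> // f.
  have fn : {in flatten ms, forall z, z < n}.
    by move=> z /flattenP[m /msl/ln]; apply.
  rewrite -weight_flatten (weight_count _ un) (weight_count _ fn) big_distrr /=.
  apply: leq_sum => i _; rewrite mulnA leq_mul2r; apply/orP; right.
  by have := Dle i (ltn_ord i); rewrite /D subr_le0 lez_nat.
have [rle _] := eval_N0 v r.
have [_ [m ml mE]] := eval_N0 v l.
have /vL : D [:: m] \in [seq D [:: m] | m <- monomials l] by apply/mapP; exists m.
have : weight v u <= weight v m by rewrite mE (lr v) rle.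
rewrite (weight_count _ un) (weight_count _ (ln _ ml)).
rewrite (eq_bigr (fun i : 'I_n =>
  (count_mem (i : nat) u * v i)%N%:Z - (count_mem (i : nat) m * v i)%N%:Z)%R).
  rewrite sumrB -!(big_morph Posz PoszD (erefl (Posz 0))) subr_gt0 ltz_nat.
  by rewrite ltnNge => ->.
by move=> i _; rewrite /D /= cats0 mul1n; lia.
Qed.

Lemma sum_leq_size (T : eqType) (F : T -> nat) (D : nat) (s : seq T) :
  (forall m, m \in s -> F m <= D) -> \sum_(m <- s) F m <= size s * D.
Proof.
move=> FD; rewrite -sum1_size big_distrl /= big_seq [leqRHS]big_seq leq_sum //.
by move=> m /FD; rewrite mul1n.
Qed.

(** A mean of numbers at most [D] reaches [D] only if all of them equal [D]. The inequalities for
    [g] and [f - g] then add up to an equality, so each is one. *)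
Lemma exact_domination (f : nat -> nat) (D : nat) u ms :
  (forall g, size ms * weight g u <= \sum_(m <- ms) weight g m) ->
  (forall m, m \in ms -> weight f m <= D) -> weight f u = D ->
  (forall m, m \in ms -> weight f m = D) /\
  forall g, (forall z, g z <= f z) ->
    size ms * weight g u = \sum_(m <- ms) weight g m.
Proof.
move=> dom fms fu.
have le := sum_leq_size fms.
have eq : \sum_(m <- ms) weight f m = size ms * D.
  by apply/eqP; rewrite eqn_leq le -fu dom.
split=> [m mms|g gf].
  apply/eqP; rewrite eqn_leq fms //= leqNgt; apply/negP => lt.
  suff : \sum_(m <- ms) weight f m < size ms * D by rewrite eq ltnn.
  rewrite (perm_size (perm_to_rem mms)) (perm_big _ (perm_to_rem mms)) big_cons /= mulSn.
  by rewrite -addSn leq_add // sum_leq_size // => x /mem_rem /fms.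
have fE m : weight f m = weight g m + weight (fun z => f z - g z) m.
  by rewrite -weightD; apply: eq_bigr => z _; rewrite subnKC.
have := dom (fun z => f z - g z); have := dom g.
have : size ms * weight f u = \sum_(m <- ms) weight f m by rewrite eq fu.
rewrite fE (eq_bigr _ (fun m _ => fE m)) big_split /= mulnDr; lia.
Qed.

(** The domination is tested on the indicator function of [z]. *)
Lemma domination_support u ms z :
  (forall g, size ms * weight g u <= \sum_(m <- ms) weight g m) ->
  0 < size ms -> z \in u -> exists2 m, m \in ms & z \in m.
Proof.
move=> dom ms0 zu; have := dom (fun y => y == z).
have u0 := mem_leq_weight (fun y => y == z) zu; rewrite eqxx in u0.
rewrite -weight_flatten => le.
have : 0 < weight (fun y => y == z) (flatten ms).
  by apply: leq_trans le; rewrite muln_gt0 ms0.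
rewrite lt0n sum_nat_seq_neq0 => /hasP[y /flattenP[m mms ym]] /=.
by rewrite eqb0 negbK => /eqP <-; exists m.
Qed.

(** * The algebras [graded p] *)

Definition kind_join (a b : option bool) := if a == b then a else None.

Lemma kind_joinP a b c : kind_join a b = Some c <-> a = Some c /\ b = Some c.
Proof.
rewrite /kind_join; case: eqP => [->|ab]; first by split=> [->|[]].
by split=> // -[ac bc]; rewrite ac bc in ab.
Qed.

Section Graded.
Variable p : nat.

(* [Some (i, k)] has degree [i.+1]; [Some true] and [Some false] are the two
   pure kinds, [None] is the mixed one.  A sum of the two pure kinds of degree p is
   mixed but finite, whereas a mixed product of degree p is the absorbing [None].
   The indices are not in ['I_p], whose universe is too large for [algebra]. *)
Definition graded : algebra :=
  {| carrier := option ({i : nat | i < p} * option bool);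
     add := fun x y =>
       if (x, y) is (Some (i, a), Some (j, b)) then
         if val i < val j then y else if val j < val i then x else Some (i, kind_join a b)
       else None;
     mul := fun x y =>
       if (x, y) is (Some (i, a), Some (j, b)) then
         if ((val i + val j).+2 == p) && (kind_join a b == None) then None
         else omap (fun k : {i | i < p} => (k, kind_join a b)) (insub (val i + val j).+1)
       else None;
     carrier_inhabited := inhabits None |}.

(** The absorbing element gets a degree above all others, so that [deg] turns sums into maxima
    without exception. *)
Definition deg (x : graded) : nat := if x is Some (i, _) then (val i).+1 else p.+1.

Definition kind (x : graded) : option bool := if x is Some (_, a) then a else None.

Lemma deg_gt0 x : 0 < deg x. Proof. by case: x => [[]|]. Qed.

Lemma deg_le x : deg x <= p.+1.
Proof. by case: x => [[[i ip] a]|] //=; apply: leqW. Qed.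

Lemma deg_kind_inj x y : deg x = deg y -> kind x = kind y -> x = y.
Proof.
case: x y => [[i a]|] [[j b]|] //=.
- by move=> [/val_inj ->] ->.
- by move=> [ip]; have := svalP i; rewrite ip ltnn.
- by move=> [ip]; have := svalP j; rewrite -ip ltnn.
Qed.

Lemma kind_infty x : p < deg x -> kind x = None.
Proof. by case: x => [[[i ip] a]|] //=; rewrite ltnNge ip. Qed.

Lemma deg_add x y : deg (add x y) = maxn (deg x) (deg y).
Proof.
case: x y => [[[i ip] a]|] [[[j jp] b]|] //=; try lia.
by case: (ltngtP i j) => ij /=; lia.
Qed.

Lemma kind_add x y : kind (add x y) =
  if deg x < deg y then kind y else if deg y < deg x then kind x
  else kind_join (kind x) (kind y).
Proof.
case: x y => [[[i ip] a]|] [[[j jp] b]|] /=; rewrite ?ltnS.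
- by case: (ltngtP i j).
- by rewrite ip.
- by rewrite jp ltnNge (ltnW jp).
- by rewrite ltnn.
Qed.

Definition collapses x y :=
  (p < deg x + deg y) ||
  ((deg x + deg y == p) && (kind_join (kind x) (kind y) == None)).

Lemma deg_mul x y :
  deg (mul x y) = if collapses x y then p.+1 else deg x + deg y.
Proof.
rewrite /collapses; case: x y => [[i a]|] [[j b]|] //=; last 3 first.
- by rewrite addnC addSn ltnS leq_addr.
- by rewrite addSn ltnS leq_addr.
- by rewrite addSn ltnS leq_addr.
rewrite addnS addSn; case: (_ && _) => /=; first by rewrite orbT.
rewrite orbF; case: insubP => [k kp kE|] /=; last by rewrite -leqNgt ltnS => ->.
by rewrite ltnNge kp /= ?kE.
Qed.

Lemma kind_mul x y :
  kind (mul x y) = if collapses x y then None else kind_join (kind x) (kind y).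
Proof.
rewrite /collapses; case: x y => [[i a]|] [[j b]|] //=; last 3 first.
- by rewrite addnC addSn ltnS leq_addr.
- by rewrite addSn ltnS leq_addr.
- by rewrite addSn ltnS leq_addr.
rewrite addnS addSn; case: (_ && _) => /=; first by rewrite orbT.
rewrite orbF; case: insubP => [k kp kE|] /=; last by rewrite -leqNgt ltnS => ->.
by rewrite ltnNge kp /= ?kE.
Qed.


Lemma monomials_nonempty t : {in monomials t, forall m, 0 < size m}.
Proof.
elim: t => [n|s IHs t IHt|s IHs t IHt] m /=; first by rewrite inE => /eqP->.
  by rewrite mem_cat => /orP[/IHs|/IHt].
by move=> /allpairsP[[a b] /= [/IHs sa _ ->]]; rewrite size_cat ltn_addr.
Qed.

(** * Values in [graded p] read off the monomials *)

Section Evaluation.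
Variable v : nat -> graded.

Definition degree : seq nat -> nat := weight (deg \o v).

Definition pure (c : bool) (m : seq nat) := all (fun z => kind (v z) == Some c) m.

(** The monomials with absorbing value. A single variable of degree [p] escapes the second clause,
    as it may be mixed and yet finite. *)
Definition bad (m : seq nat) :=
  (p < degree m) ||
  [&& degree m == p, 1 < size m, ~~ pure true m & ~~ pure false m].

Lemma degree_gt0 m : 0 < size m -> 0 < degree m.
Proof. by case: m => // z m _; rewrite /degree /weight big_cons ltn_addr // deg_gt0. Qed.

Lemma degree_cat a b : degree (a ++ b) = degree a + degree b.
Proof. exact: weight_cat. Qed.

Lemma pure_inj m : 0 < size m -> pure true m -> ~~ pure false m.
Proof. by case: m => // z m _ /= /andP[/eqP-> _]. Qed.

(** The invariant of the induction on terms: a value is absorbing exactly when some monomial is bad;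
    otherwise the leading monomials determine its degree and kind. *)
Definition evaluates (t : term) (e : graded) :=
  (deg e <= p ->
    [/\ forall m, m \in monomials t -> ~~ bad m /\ degree m <= deg e,
        exists2 m, m \in monomials t & degree m = deg e &
        forall c, kind e = Some c <->
          forall m, m \in monomials t -> degree m = deg e -> pure c m]) /\
  (p < deg e -> exists2 m, m \in monomials t & bad m).

Lemma evaluates_var n : evaluates (Var n) (v n).
Proof.
have dn : degree [:: n] = deg (v n) by rewrite /degree /weight big_seq1.
split=> [vp|vp].
  split=> [m||c]; rewrite /=.
  - by rewrite inE => /eqP->; rewrite /bad dn ltnNge vp /= andbF.
  - by exists [:: n]; rewrite ?inE.
  - split=> [vc m|]; first by rewrite inE => /eqP-> _; rewrite /= vc eqxx.
    by move=> /(_ [:: n]); rewrite inE eqxx /= andbT => /(_ isT dn) /eqP.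
by exists [:: n]; rewrite ?inE // /bad dn vp.
Qed.

Lemma evaluates_add s t x y :
  evaluates s x -> evaluates t y -> evaluates (Add s t) (add x y).
Proof.
move=> [sx sx'] [ty ty']; split; rewrite deg_add; last first.
  rewrite leq_max => /orP[/sx'|/ty'] [m mt mb]; exists m => //=;
    by rewrite mem_cat mt ?orbT.
rewrite geq_max => /andP[xp yp].
have [sg [a sa ax] sk] := sx xp; have [tg [b tb bY] tk] := ty yp.
split=> [m|/=|c /=].
- by rewrite mem_cat leq_max => /orP[/sg|/tg] [-> ->]; rewrite ?orbT.
- case: (leqP (deg x) (deg y)) => xy.
    by exists b; rewrite ?mem_cat ?tb ?orbT.
  by exists a; rewrite ?mem_cat ?sa.
- rewrite kind_add; case: (ltngtP (deg x) (deg y)) => xy.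
  + rewrite tk; split=> h m; last by move=> mt; apply: h; rewrite mem_cat mt orbT.
    rewrite mem_cat => /orP[/sg[_ le] my|/h//].
    by move: le; rewrite my leqNgt xy.
  + rewrite sk; split=> h m; last by move=> mt; apply: h; rewrite mem_cat mt.
    rewrite mem_cat => /orP[/h//|/tg[_ le] my].
    by move: le; rewrite my leqNgt xy.
  + rewrite kind_joinP sk tk; split=> [[h1 h2] m|h].
      by rewrite mem_cat => /orP[ms|mt] mx; [apply: h1|apply: h2]; rewrite // mx ?xy.
    by split=> m mt mx; apply: h; rewrite ?mem_cat ?mt ?orbT ?mx ?xy.
Qed.

Lemma evaluates_mul s t x y :
  evaluates s x -> evaluates t y -> evaluates (Mul s t) (mul x y).
Proof.
move=> [sx sx'] [ty ty']; have x0 := deg_gt0 x; have y0 := deg_gt0 y.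
have d0 m u : m \in monomials u -> 0 < degree m.
  by move=> mu; apply: degree_gt0; exact: monomials_nonempty mu.
have cat a b : a \in monomials s -> b \in monomials t -> a ++ b \in monomials (Mul s t).
  by move=> sa tb; apply/allpairsP; exists (a, b).
have sz m u : m \in monomials u -> 0 < size m by exact: monomials_nonempty.
have ne u : exists m, m \in monomials u.
  elim: u => [n|u [a ua] w _|u [a ua] w [b wb]]; first by exists [:: n]; rewrite inE.
    by exists a; rewrite /= mem_cat ua.
  by exists (a ++ b); apply/allpairsP; exists (a, b).
have badS m : bad m -> p <= degree m.
  by move=> /orP[/ltnW//|/andP[/eqP->]].
split; rewrite deg_mul /collapses.
  case: ifP => [|/negbT]; first by rewrite ltnn.
  rewrite negb_or -leqNgt => /andP[xyp nj] _.
  have xp : deg x <= p by lia.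
  have yp : deg y <= p by lia.
  have [sg [a sa ax] sk] := sx xp; have [tg [b tb bY] tk] := ty yp.
  split=> [m /allpairsP[[c d] /= [sc td ->]]||c].
  - have [_ cx] := sg _ sc; have [_ dy] := tg _ td.
    rewrite degree_cat leq_add // /bad degree_cat negb_or -leqNgt.
    rewrite (leq_trans (leq_add cx dy) xyp) /=; split=> //; apply/negP.
    case/and4P => /eqP cdp _ pT pF.
    (* Degree [p] forces both factors to be leading, and then the common kind of [x] and [y] makes
       the product pure. *)
    have xy : deg x + deg y == p by lia.
    have cE : degree c = deg x by lia.
    have dE : degree d = deg y by lia.
    move: nj; rewrite xy /=; case E: (kind_join _ _) => [k|] // _.
    have [/sk xk /tk yk] := (kind_joinP _ _ _).1 E.
    have : pure k (c ++ d) by rewrite /pure all_cat [all _ c]xk ?[all _ d]yk.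
    by case: k {E xk yk} => h; [rewrite h in pT|rewrite h in pF].
  - by exists (a ++ b); [exact: cat|rewrite degree_cat ax bY].
  - rewrite kind_mul /collapses ltnNge xyp (negbTE nj) kind_joinP sk tk; split.
      move=> [h1 h2] m /allpairsP[[d e] /= [sd te ->]]; rewrite degree_cat => de.
      have [_ dx] := sg _ sd; have [_ ey] := tg _ te.
      by rewrite /pure all_cat [all _ d]h1 ?[all _ e]h2 //; lia.
    move=> h; split=> m mt mE.
      have := h _ (cat _ _ mt tb); rewrite degree_cat mE bY /pure all_cat.
      by move=> /(_ erefl) /andP[].
    have := h _ (cat _ _ sa mt); rewrite degree_cat mE ax /pure all_cat.
    by move=> /(_ erefl) /andP[].
case: ifP => [C _|/negbT]; last first.
  by rewrite negb_or -leqNgt => /andP[le _]; rewrite ltnNge le.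
(* A bad monomial of one factor has degree at least [p], and any monomial of the other factor raises
   it above [p]. *)
have [xp|/sx' [a sa abad]] := leqP (deg x) p; last first.
  have [b tb] := ne t; exists (a ++ b); first exact: cat.
  by rewrite /bad degree_cat; have := d0 _ _ tb; have := badS _ abad; lia.
have [yp|/ty' [b tb bbad]] := leqP (deg y) p; last first.
  have [a sa] := ne s; exists (a ++ b); first exact: cat.
  by rewrite /bad degree_cat; have := d0 _ _ sa; have := badS _ bbad; lia.
have [sg [a sa ax] sk] := sx xp; have [tg [b tb bY] tk] := ty yp.
have {C} [xyp|/andP[/eqP xyp /eqP nj]] := orP C.
  by exists (a ++ b); [exact: cat|rewrite /bad degree_cat ax bY xyp].
have bad_cat c d : c \in monomials s -> d \in monomials t ->
    degree c = deg x -> degree d = deg y ->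
    ~~ pure true (c ++ d) -> ~~ pure false (c ++ d) ->
    exists2 m, m \in monomials (Mul s t) & bad m.
  move=> sc td cx dy pT pF; exists (c ++ d); first exact: cat.
  rewrite /bad degree_cat cx dy xyp eqxx pT pF size_cat.
  by rewrite /= andbT (leq_add (sz _ _ sc) (sz _ _ td)) orbT.
have impure k : (exists c, [/\ c \in monomials s, degree c = deg x & ~~ pure k c]) \/
    (exists d, [/\ d \in monomials t, degree d = deg y & ~~ pure k d]).
  apply: contrapT => /not_orP[ns nt].
  have : kind_join (kind x) (kind y) = Some k.
    apply/kind_joinP; split; [apply/sk|apply/tk] => m mu mE; apply: contrapT => /negP np.
      by apply: ns; exists m.
    by apply: nt; exists m.
  by rewrite nj.
have np m u : m \in monomials u -> ~~ pure true m \/ ~~ pure false m.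
  move=> mu; case: (boolP (pure true m)) => h; last by left.
  by right; apply: pure_inj h; exact: sz mu.
have pc k c d : pure k (c ++ d) = pure k c && pure k d by exact: all_cat.
(* If both impurities lie in the same factor, a leading monomial of the other factor fails one kind
   and is joined to the monomial failing the other kind. *)
case: (impure true) => -[c [cs cE cT]]; case: (impure false) => -[d [ds dE dF]].
- case: (np _ _ tb) => bk.
    by apply: (bad_cat d b) => //; rewrite pc negb_and ?bk ?dF ?orbT.
  by apply: (bad_cat c b) => //; rewrite pc negb_and ?bk ?cT ?orbT.
- by apply: (bad_cat c d) => //; rewrite pc negb_and ?cT ?dF ?orbT.
- by apply: (bad_cat d c) => //; rewrite pc negb_and ?cT ?dF ?orbT.
- case: (np _ _ sa) => bk.
    by apply: (bad_cat a d) => //; rewrite pc negb_and ?bk ?dF ?orbT.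
  by apply: (bad_cat a c) => //; rewrite pc negb_and ?bk ?cT ?orbT.
Qed.

Lemma evalP t : evaluates t (eval v t).
Proof.
elim: t => [n|s IHs t IHt|s IHs t IHt] /=.
- exact: evaluates_var.
- exact: evaluates_add.
- exact: evaluates_mul.
Qed.

(** The degree of [u] is at most a mean of degrees at most [p]. If it equals [p], the domination is
    exact, and primality prevents [u] from mixing the two kinds. *)
Lemma dominated_not_bad u ms : prime p -> 0 < size ms < p ->
  (forall g, size ms * weight g u <= \sum_(m <- ms) weight g m) ->
  {in ms, forall m, 0 < size m} ->
  {in ms, forall m, ~~ bad m} -> ~~ bad u.
Proof.
move=> pp /andP[ms0 msp] dom ms1 good.
have degp m : m \in ms -> degree m <= p.
  by move=> /good; rewrite negb_or -leqNgt => /andP[].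
rewrite negb_or -leqNgt; apply/andP; split.
  rewrite -(leq_pmul2l ms0); apply: leq_trans (dom _) _.
  exact: sum_leq_size degp.
apply/negP => /and4P[/eqP up u1 uT uF].
have [msE0 exact] := exact_domination dom degp up.
have msE m : m \in ms -> degree m = p by exact: msE0.
have deg0 z : 0 < deg (v z) by exact: deg_gt0.
have [[m mms /andP[mT mF]]|all_pure] :=
    pselect (exists2 m, m \in ms & ~~ pure true m && ~~ pure false m).
  (* A good monomial of degree [p] that is not pure is a single variable [z]. By exactness [z]
     occurs in [u], next to another letter, so [u] would exceed degree [p]. *)
  have m1 : size m <= 1.
    rewrite leqNgt; apply/negP => m2; move: (good _ mms).
    by rewrite /bad negb_or (msE _ mms) eqxx mT mF m2 andbF.
  have [z mz] : exists z, m = [:: z].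
    by have := ms1 _ mms; case: m m1 {mms mT mF} => [|z []] //; exists z.
  have zp : deg (v z) = p by have := msE _ mms; rewrite mz /degree /weight big_seq1.
  have zu : z \in u.
    pose g y := if y == z then deg (v y) else 0.
    have gE : size ms * weight g u = \sum_(m <- ms) weight g m.
      by apply: exact => y; rewrite /g; case: ifP.
    have : 0 < weight g u.
      rewrite -(ltn_pmul2l ms0) muln0 gE (big_rem m) //= ltn_addr //.
      by rewrite mz /weight big_seq1 /g eqxx.
    rewrite lt0n sum_nat_seq_neq0 => /hasP[y yu] /=.
    by rewrite /g; case: (y =P z) => [<-|].
  have : degree u = deg (v z) + degree (rem z u).
    by rewrite /degree /weight (big_rem z).
  have : 0 < degree (rem z u).
    by apply: degree_gt0; rewrite size_rem // -ltnS prednK // ltnW.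
  by rewrite up zp; lia.
have ispure m : m \in ms -> pure true m || pure false m.
  move=> mms; apply: contrapT => /negP; rewrite negb_or => h.
  by apply: all_pure; exists m.
(* The share of the degree due to kind [true]: it is 0 or [p] on each member of [ms]. As [size ms]
   is prime to [p], it is also 0 or [p] on [u], which makes [u] pure. *)
pose b z := if kind (v z) == Some true then deg (v z) else 0.
have bE m : m \in ms -> weight b m = if pure true m then p else 0.
  move=> mms; case: ifP => mT.
    apply: etrans (msE _ mms); apply: eq_big_seq => z zm.
    by rewrite /b (allP mT _ zm).
  have := ispure _ mms; rewrite mT /= => /allP mF.
  by rewrite /weight big_seq big1 // => z /mF /eqP zF; rewrite /b zF.
have bd z : b z <= deg (v z) by rewrite /b; case: ifP.
have pu : p %| weight b u.
  have : p %| size ms * weight b u.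
    rewrite exact // big_seq dvdn_sum // => m /bE ->; case: ifP => _ //; exact: dvdn0.
  by rewrite Gauss_dvdr // prime_coprime // gtnNdvd.
have bup : weight b u <= p by rewrite -up; apply: leq_weight.
have kindu z : z \in u -> kind (v z) = Some true \/ kind (v z) = Some false.
  move=> zu; have [m mms zm] := domination_support dom ms0 zu.
  by case/orP: (ispure _ mms) => /allP/(_ _ zm)/eqP; [left|right].
case: (posnP (weight b u)) => [bu0|bu0].
  case/negP: uF; apply/allP => z zu; apply/eqP; case: (kindu z zu) => // zT.
  by have := mem_leq_weight b zu; rewrite bu0 /b zT eqxx leqNgt deg0.
have bup' : weight b u = p by apply/eqP; rewrite eqn_leq bup dvdn_leq.
case/negP: uT; apply/allP => z zu; apply/eqP; case: (kindu z zu) => // zF.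
have := mem_leq_weight (fun y => deg (v y) - b y) zu.
have : weight (fun y => deg (v y) - b y) u + weight b u = p.
  by rewrite -weightD -[RHS]up; apply: eq_bigr => y _; rewrite subnK.
by rewrite bup' /b zF /=; have := deg0 z; lia.
Qed.

End Evaluation.


(** * Transfer of identities to [graded p] *)

Definition certified (l r : term) := forall u, u \in monomials r ->
  exists ms, [/\ 0 < size ms < p, {subset ms <= monomials l} &
    forall f, size ms * weight f u <= \sum_(m <- ms) weight f m].

(** Badness, a larger degree or, at equal degree, a loss of purity cannot arise in [r] alone. A
    mixed value of [l] is left to the reverse certificate. *)
Lemma certified_eval l r (v : nat -> graded) :
  prime p -> certified l r -> deg (eval v l) <= p ->
  deg (eval v r) <= deg (eval v l) /\
  (deg (eval v r) = deg (eval v l) ->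
   forall c, kind (eval v l) = Some c -> kind (eval v r) = Some c).
Proof.
move=> pp cert lp; have [/(_ lp) [lgood _ lkind] _] := evalP v l.
have [rok rbad] := evalP v r.
have rp : deg (eval v r) <= p.
  rewrite leqNgt; apply/negP => /rbad [u /cert [ms [msp msl dom]]]; apply/negP.
  apply: dominated_not_bad pp msp dom _ _ => m /msl; first exact: monomials_nonempty.
  by move=> /lgood [].
have [rgood [u0 ru0 u0E] rkind] := rok rp.
have mle (ms : seq (seq nat)) m : {subset ms <= monomials l} -> m \in ms ->
    weight (deg \o v) m <= deg (eval v l).
  by move=> msl /msl /lgood [].
split=> [|lr c /lkind lc].
  have [ms [/andP[ms0 _] msl dom]] := cert _ ru0.
  rewrite -u0E -(leq_pmul2l ms0); apply: leq_trans (dom _) _.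
  by apply: sum_leq_size => m /(mle ms _ msl).
apply/rkind => u ru; rewrite lr => uE.
have [ms [/andP[ms0 _] msl dom]] := cert _ ru.
(* Equal degrees make all of [ms] leading in [l], hence pure of kind [c], and each letter of [u]
   occurs in one of them. *)
have [msE _] := exact_domination dom (fun m => mle ms m msl) uE.
apply/allP => z zu; have [m mms zm] := domination_support dom ms0 zu.
exact: (allP (lc _ (msl _ mms) (msE _ mms)) _ zm).
Qed.

Lemma certified_satisfies l r :
  prime p -> certified l r -> certified r l -> satisfies graded (l, r).
Proof.
move=> pp lr rl v /=.
have [lp|lp] := leqP (deg (eval v l)) p; last first.
  have [rp|rp] := leqP (deg (eval v r)) p.
    by have [] := certified_eval pp rl rp; lia.
  apply: deg_kind_inj; last by rewrite !kind_infty.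
  by have := deg_le (eval v l); have := deg_le (eval v r); lia.
have [le1 k1] := certified_eval pp lr lp.
have [le2 k2] := certified_eval pp rl (leq_trans le1 lp).
have dE : deg (eval v l) = deg (eval v r) by lia.
apply: deg_kind_inj => //.
case El: (kind (eval v l)) => [c|]; first by rewrite (k1 (esym dE) c).
by case Er: (kind (eval v r)) => [c|] //; rewrite (k2 dE c) in El.
Qed.

End Graded.

(** * The variety has no finite basis *)

(** There are finitely many monomials in [r], so the denominators have a common bound. *)
Lemma certified_large l r : satisfies N0_max_plus (l, r) ->
  exists N, forall p, N < p -> certified p l r.
Proof.
move=> lr; rewrite /certified.
have : {subset monomials r <= monomials r} by [].
elim: {1 3}(monomials r) => [|u L IH] sub; first by exists 0.
have [|N NL] := IH; first by move=> m mL; apply: sub; rewrite inE mL orbT.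
have [|ms [ms0 msl dom]] := convex_domination lr (u := u).
  by apply: sub; rewrite inE eqxx.
exists (maxn N (size ms)) => p; rewrite gtn_max => /andP[Np sp] w.
by rewrite inE => /orP[/eqP->|/(NL _ Np)//]; exists ms; rewrite ms0 sp.
Qed.

Lemma graded_satisfies (e : identity) : satisfies N0_max_plus e ->
  exists N, forall p, prime p -> N < p -> satisfies (graded p) e.
Proof.
case: e => l r lr.
have [N NP] := certified_large lr.
have [M MP] : exists N, forall p, N < p -> certified p r l.
  by apply: certified_large => v; rewrite -[LHS]/(eval v r) [RHS](lr v).
exists (maxn N M) => p pp; rewrite gtn_max => /andP[Np Mp].
by apply: certified_satisfies; [|exact: NP|exact: MP].
Qed.

(* [power z n] is the power [z ^ n.+1]. *)
Definition power (z n : nat) : term := iter n (Mul (Var z)) (Var z).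

(** For [n = p - 1 > 0], the absorption of [x^(p-1) y] by [x^p + y^p]; the predecessor offsets the
    shift in [power]. *)
Definition mixing_identity (n : nat) : identity :=
  let s := Add (power 0 n) (power 1 n) in
  (s, Add s (Mul (power 0 n.-1) (Var 1))).

Lemma N0_mixing n : 0 < n -> satisfies N0_max_plus (mixing_identity n).
Proof.
case: n => // n _ v.
have pE z k : eval (A := N0_max_plus) v (power z k) = k.+1 * v z.
  by elim: k => [|k IHk] /=; rewrite ?mul1n // mulSn -IHk.
rewrite /= -/(power 0 n) !pE.
have mono x y : x <= y -> n.+1 * x <= n.+1 * y by rewrite leq_mul2l => ->.
have := mono (v 0) (v 1); have := mono (v 1) (v 0).
lia.
Qed.

Lemma graded_mixing n : ~ satisfies (graded n.+2) (mixing_identity n.+1).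
Proof.
(* With [x] and [y] of degree 1 and opposite kinds, the left side has degree [p = n + 2], while the
   mixed product on the right collapses. *)
pose v z : graded n.+2 := Some (Sub 0 isT, Some (z == 0)).
have pE z k : k <= n.+1 ->
    deg (eval v (power z k)) = k.+1 /\ kind (eval v (power z k)) = Some (z == 0).
  elim: k => [//|k IHk kn]; have [dE kE] := IHk (ltnW kn).
  rewrite -[eval _ _]/(mul (v z) (eval v (power z k))).
  rewrite deg_mul kind_mul /collapses dE kE /kind_join eqxx andbF orbF /=.
  by rewrite ltnNge add1n ltnS kn.
move=> /(_ v) /(congr1 (@deg _)).
pose s := add (eval v (power 0 n.+1)) (eval v (power 1 n.+1)).
rewrite -[LHS]/(deg s) -[RHS]/(deg (add s (mul (eval v (power 0 n)) (v 1)))) {}/s.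
rewrite !deg_add !(pE _ _ _).1 // deg_mul /collapses.
have [dE kE] := pE 0 n (leqnSn n).
by rewrite dE kE /= addn1 eqxx orbT maxnn; lia.
Qed.

(** For a prime [p] above the thresholds of all identities in a finite basis, [graded p] would
    satisfy the basis but not a mixing identity. *)
Lemma N0_not_finitely_based : nonfinitely_based (V N0_max_plus).
Proof.
move=> [E [finE EV Ebase]].
have bound e : exists N, E e -> forall p, prime p -> N < p -> satisfies (graded p) e.
  have [Ee|nE] := pselect (E e); last by exists 0.
  by have [N NP] := graded_satisfies (EV _ Ee _ (@V_gen _)); exists N.
have [N NP] := choice bound.
have /finite_seqP [s sE] : finite_set (N @` E)%classic by exact: finite_image.
have [p sp pp] := prime_above (\max_(k <- s) k).
have Ep e : E e -> satisfies (graded p) e.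
  move=> Ee; apply: NP => //; apply: leq_ltn_trans sp.
  have : [set` s]%classic (N e) by rewrite -sE; exists e.
  by move=> /= Ns; apply: (@leq_bigmax_seq _ _ xpredT id).
case: p pp sp Ep => [|[|n]] // pp _ Ep.
apply: (@graded_mixing n); apply: (Ebase _ _ _ Ep).
by apply: V_satisfies; apply: N0_mixing.
Qed.

Theorem theorem9p1 :
  [/\ V Sc_star_aplus = variety_join [set n : nat | 1 <= n]%classic (fun n => V (Sc_star n)),
      variety_join [set n : nat | 1 <= n]%classic (fun n => V (Sc_star n)) = V N0_max_plus &
      nonfinitely_based (V Sc_star_aplus)].
Proof.
have VN : V Sc_star_aplus = V N0_max_plus.
  by apply/seteqP; split; apply: V_min;
    by [exact: smallest_variety|exact: aplus_in_N0|exact: N0_in_aplus].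
have Vjoin : V Sc_star_aplus =
    variety_join [set n : nat | 1 <= n]%classic (fun n => V (Sc_star n)).
  apply/seteqP; split.
    apply: V_min; first exact: smallest_variety.
    apply: aplus_in_variety (smallest_variety _) _ => n n0 K [vK]; apply.
    by exists n => //; exact: V_gen.
  move=> A; apply; split=> [|B [n _]]; first exact: smallest_variety.
  exact: (V_min (smallest_variety _) (@Sc_star_in_aplus n)).
by split; rewrite -?Vjoin // VN //; exact: N0_not_finitely_based.
Qed.
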